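(* Let $(X,\|\cdot\|)$ be a normed space and let $G:X\rightrightarrows X$ be a set-valued mapping. Let $U\subset X$ be a nonempty open set and let $L\subset S_X$ be nonempty. Assume that: (i) $G$ is directionally orbitally Aubin continuous on $U$ w.r.t. $L$ and w.r.t. $-L$ with constant $\tau\in(0,1)$; (ii) there exists $\overline{x}\in U$ such that one of the following conditions holds: $(\alpha)$ $T_L(\overline{x},G(\overline{x}))<(1-\tau)\mathbf{d}(\overline{x},X\setminus U)$; $(\beta)$ $T_{-L}(\overline{x},G(\overline{x}))<(1-\tau)\mathbf{d}(\overline{x},X\setminus U)$. Then the following assertions hold. (a) There exists a sequence $(x_k)_{k\in\mathbb{N}}\subset X$ of successive approximations of $G$ starting from $\overline{x}$ w.r.t. $L$ such that, for every $\varepsilon>0$, there exists $k_\varepsilon\in\mathbb{N}$ such that for all $k\ge k_\varepsilon$, $$x_k\in\operatorname{Fix}(G)(\varepsilon)\cap U,$$ and, moreover, either $T_L(x_k,G(x_k))\le\varepsilon$ or $T_{-L}(x_k,G(x_k))\le\varepsilon$. Furthermore, for every $\varepsilon>0$, if $(\alpha)$ holds, then $$\mathbf{d}\bigl(\overline{x},\operatorname{Fix}(G)(\varepsilon)\cap U\bigr)\le\frac{T_L(\overline{x},G(\overline{x}))}{1-\tau},$$ whereas if $(\beta)$ holds, then $$\mathbf{d}\bigl(\overline{x},\operatorname{Fix}(G)(\varepsilon)\cap U\bigr)\le\frac{T_{-L}(\overline{x},G(\overline{x}))}{1-\tau}.$$ (b) If $X$ is a Banach space and $G$ has closed graph, then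 $\operatorname{Fix}(G)\cap U\neq\emptyset$. Moreover, if $(\alpha)$ holds, then $$\mathbf{d}\bigl(\overline{x},\operatorname{Fix}(G)\cap U\bigr)\le\frac{T_L(\overline{x},G(\overline{x}))}{1-\tau},$$ while if $(\beta)$ holds, then $$\mathbf{d}\bigl(\overline{x},\operatorname{Fix}(G)\cap U\bigr)\le\frac{T_{-L}(\overline{x},G(\overline{x}))}{1-\tau}.$$
   Context: $S_X$ is the unit sphere of $X$; $\mathbf{d}(x,A)=\inf_{a\in A}\|x-a\|$ with $\mathbf{d}(x,\emptyset)=+\infty$. For $\emptyset\ne L\subset S_X$ and $A\subset X$, the directional minimal time function is $T_L(x,A):=\inf\{t\ge 0:(x+tL)\cap A\ne\emptyset\}$ with $\inf\emptyset=+\infty$, and $T_L(x,u):=T_L(x,\{u\})$. $\operatorname{Fix}(G)(\varepsilon):=\{x\in X:\mathbf{d}(x,G(x))\le\varepsilon\}$ and $\operatorname{Fix}(G):=\{x\in X:x\in G(x)\}$. A sequence $(x_k)_{k\in\mathbb{N}}\subset X$ is a sequence of successive approximations of $G$ starting from $\overline{x}$ w.r.t. $L$ if there exist sequences $(t_k)\subset\mathbb{R}$ (signs allowed) and $(u_k)\subset L$ such that $x_0=\overline{x}$, $t_k\to0$, and $x_{k+1}=x_k+t_ku_k\in G(x_k)$ for all $k\in\mathbb{N}$. $G$ is directionally orbitally Aubin continuous on $U$ w.r.t. $L$ with constant $\tau>0$ if for every $x\in U$ and $u\in X$: $x\in G(u)$ and $\tau T_L(x,u)<\mathbf{d}(x,X\setminus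 U)$ imply $T_L(x,G(x))\le\tau T_L(x,u)$. *)

(* Defs.v *)
From mathcomp Require Import all_boot all_order all_algebra.
From mathcomp Require Import all_classical all_reals all_analysis.

Set Implicit Arguments.
Unset Strict Implicit.
Unset Printing Implicit Defensive.

Import Order.TTheory GRing.Theory Num.Theory.
Import numFieldNormedType.Exports.

Local Open Scope classical_set_scope.
Local Open Scope ring_scope.

Section Definitions.
Context {R : realType} {X : normedModType R}.
Implicit Types (x u : X) (A U L : set X) (G : X -> set X) (tau eps : R).

(* The value is [+oo] for [A = set0]. *)
Definition dist x A : \bar R := ereal_inf [set `|x - a|%:E | a in A].

Lemma dist_edist_inf x A : dist x A = edist_inf A x.
Proof.
congr ereal_inf; apply: eq_imagel => a _.
apply/esym/eqP; rewrite eq_le; apply/andP; split.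
  apply/lee_addgt0Pr => e e0; apply: ereal_inf_lbound.
  exists (`|x - a| + e) => //=; split; first by rewrite ltr_wpDl.
  by rewrite -ball_normE /= ltrDl.
apply: le_ereal_inf_tmp => _ [r [r0]] + <-.
by rewrite -ball_normE /= lee_fin => /ltW.
Qed.

Definition sphere1 : set X := [set u | `|u| = 1].

Definition oppset L : set X := [set - u | u in L].

Definition dir_min_time L x A : \bar R :=
  ereal_inf [set t%:E |
    t in [set t : R | 0 <= t /\ [set x + t *: u | u in L] `&` A !=set0]].

Definition Fix_approx G eps : set X := [set x | (dist x (G x) <= eps%:E)%E].

Definition Fixset G : set X := [set x | G x x].

Definition successive_approximations G L x (s : nat -> X) : Prop :=
  exists (t : nat -> R) (u : nat -> X),
    [/\ forall k, L (u k), s 0%N = x, t @ \oo --> (0 : R) &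
        forall k, s k.+1 = s k + t k *: u k /\ G (s k) (s k.+1)].

Definition dir_orbitally_Aubin G U L tau : Prop :=
  forall x u, U x -> G u x ->
    (tau%:E * dir_min_time L x [set u] < dist x (~` U))%E ->
    (dir_min_time L x (G x) <= tau%:E * dir_min_time L x [set u])%E.

Definition closed_graph G : Prop := closed [set p : X * X | G p.1 p.2].

End Definitions.

(* The axiom of [completeNormedModType], as a proposition on a given space. *)
Definition complete_space {R : realType} (X : normedModType R) : Prop :=
  forall F : set_system X, ProperFilter F -> cauchy F -> cvg F.

(* Main.v *)
(** From [x_k], a step [x_(k+1) = x_k + t_k u_k] into [G x_k] with [u_k] in [M]
    puts [x_k] at distance at most [t_k] from [x_(k+1)] in direction [- M]. Orbital
    Aubin continuity with respect to [- M], at [x_(k+1)] in [G x_k], then bounds the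
    minimal time from [x_(k+1)] to [G x_(k+1)] in direction [- M] by [tau t_k]. Hence
    the iteration continues with the sign of the direction flipped at each step and
    with step lengths decaying geometrically. For every [rho] strictly between
    [T / (1 - tau)] and the distance to the complement of [U], such a zigzag can be
    kept in the closed ball of radius [rho], and letting [rho] decrease to
    [T / (1 - tau)] gives the estimates. *)
Require Import Defs.
From mathcomp Require Import all_boot all_order all_algebra.
From mathcomp Require Import all_classical all_reals all_analysis.
From mathcomp Require Import lra.

Set Implicit Arguments.
Unset Strict Implicit.
Unset Printing Implicit Defensive.

Import Order.TTheory GRing.Theory Num.Theory.
Import numFieldNormedType.Exports.

Local Open Scope classical_set_scope.
Local Open Scope ring_scope.

(** * Direction sets, distances and minimal times *)

Section Preliminaries.
Context {R : realType} {X : normedModType R}.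
Implicit Types (x y u : X) (A U M : set X) (G : X -> set X) (s : nat -> X).

Lemma oppsetK M : oppset (oppset M) = M.
Proof.
apply/seteqP; split => [_ [_ [u Mu <-] <-]|u Mu]; first by rewrite opprK.
by exists (- u); [exists u | rewrite opprK].
Qed.

Lemma oppset_sphere1 M : M `<=` sphere1 -> oppset M `<=` sphere1.
Proof. by move=> MS _ [u Mu <-]; rewrite /sphere1/= normrN; exact: MS. Qed.

Lemma dist_le_norm x y A : A y -> (dist x A <= `|x - y|%:E)%E.
Proof. by move=> Ay; apply: ereal_inf_lbound; exists y. Qed.

Lemma dist_ge x A r : (forall y, A y -> r <= `|x - y|) -> (r%:E <= dist x A)%E.
Proof. by move=> h; apply: le_ereal_inf_tmp => _ [y Ay <-]; rewrite lee_fin h. Qed.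

Lemma dir_min_time_le M x A t u : 0 <= t -> M u -> A (x + t *: u) ->
  (dir_min_time M x A <= t%:E)%E.
Proof.
move=> t0 Mu Axtu; apply: ereal_inf_lbound; exists t => //=; split=> //.
by exists (x + t *: u); split=> //; exists u.
Qed.

Lemma dir_min_time_ge0 M x A : (0 <= dir_min_time M x A)%E.
Proof. by apply: le_ereal_inf_tmp => _ [t [t0 _] <-]; rewrite lee_fin. Qed.

Lemma dir_min_time_ltP M x A (r : R) : (dir_min_time M x A < r%:E)%E ->
  exists t u, [/\ 0 <= t, t < r, M u & A (x + t *: u)].
Proof.
move=> /ereal_inf_lt[_ [t [t0 [_ [[u Mu <-] Axtu]]] <-]]; rewrite lte_fin => tr.
by exists t, u.
Qed.

(** A step of time [t] along a unit vector has length [t]. This turns bounds on minimal times into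
    membership in [Fix_approx]. *)
Lemma dist_le_dir_min_time M x A : M `<=` sphere1 ->
  (dist x A <= dir_min_time M x A)%E.
Proof.
move=> MS; apply: le_ereal_inf_tmp => _ [t [t0 [_ [[u Mu <-] Axtu]]] <-].
apply: le_trans (dist_le_norm _ Axtu) _.
by rewrite opprD addNKr normrN normrZ (MS u Mu) mulr1 ger0_norm.
Qed.

(** Step lengths are signed, so negating both [t k] and [u k] keeps every increment. *)
Lemma successive_approximations_oppset G M x s :
  successive_approximations G (oppset M) x s -> successive_approximations G M x s.
Proof.
move=> [t [u [Mu s0 t0 Gs]]]; exists (fun k => - t k), (fun k => - u k); split=> //.
- by move=> k; have [v Mv <-] := Mu k; rewrite opprK.
- by rewrite -oppr0; exact: cvgN.
- by move=> k; rewrite scaleNr scalerN opprK.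
Qed.

End Preliminaries.

(** The upper end may be [+oo], as happens for the distance to the complement of [U] when [U] is the
    whole space; the radius must still be real. *)
Lemma ereal_between {R : realType} (a b : \bar R) : (0 <= a)%E -> (a < b)%E ->
  exists r : R, (a < r%:E < b)%E.
Proof.
case: a b => [a| |] [b| |] //= _; rewrite ?ltxx//.
- rewrite lte_fin => ab; exists ((a + b) / 2).
  by rewrite !lte_fin; apply/andP; split; lra.
- move=> _; exists (a + 1); rewrite lte_fin ltrDl ltr01 /=; exact: ltry.
Qed.

(** * The zigzag iteration in a fixed closed ball *)

Section Zigzag.
Context {R : realType} {X : normedModType R}.
Variables (G : X -> set X) (U M : set X) (tau rho : R) (xbar : X).
Hypothesis MS : M `<=` sphere1.
Hypothesis tau01 : 0 < tau < 1.
Hypothesis GM : dir_orbitally_Aubin G U M tau.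
Hypothesis GNM : dir_orbitally_Aubin G U (oppset M) tau.
Hypothesis ballU : forall x, `|x - xbar| <= rho -> U x.

(** The argument will be [odd k], so that the parity of a step selects its direction set. *)
Let dir (b : bool) := if b then oppset M else M.

Let dir_opp b u : dir b u -> dir (~~ b) (- u).
Proof. by case: b => [[v Mv <-]|Mu]; [rewrite /= opprK | exists u]. Qed.

Let dir_sphere1 b : dir b `<=` sphere1.
Proof. by case: b => //; exact: oppset_sphere1. Qed.

Let GD b : dir_orbitally_Aubin G U (dir b) tau.
Proof. by case: b. Qed.

(* [q > tau] absorbs the gap between the infimum defining the minimal time and
   an actual step; with [r = (1 - q) rho] the steps [r q ^ k] add up to [rho]. *)
Let invariant (q : R) k x := `|x - xbar| <= rho * (1 - q ^+ k) /\
  (dir_min_time (dir (odd k)) x (G x) < ((1 - q) * rho * q ^+ k)%:E)%E.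

(** The point [x] is reached from the new point along [- u] in time [t], so the Aubin property
    there, in the flipped direction, gives a minimal time at most [tau * t], below the next
    threshold because [tau < q]. *)
Let invariant_step q k x : tau < q < 1 -> 0 < rho -> invariant q k x ->
  exists t u, [/\ 0 <= t <= (1 - q) * rho * q ^+ k, dir (odd k) u,
    G x (x + t *: u) & invariant q k.+1 (x + t *: u)].
Proof.
move=> /andP[tq q1] rho0 [xk /dir_min_time_ltP[t [u [t0 tr Mu Gx]]]].
have /andP[tau0 tau1] := tau01.
have qk0 : 0 < q ^+ k by rewrite exprn_gt0// (lt_trans tau0).
exists t, u; split=> //; first by rewrite t0 ltW.
set y := x + t *: u in Gx *.
(* Geometric partial sum: [rho * (1 - q ^+ k) + (1 - q) * rho * q ^+ k] equals
   [rho * (1 - q ^+ k.+1)]. *)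
have yk : `|y - xbar| <= rho * (1 - q ^+ k.+1).
  rewrite /y addrAC (le_trans (ler_normD _ _))// normrZ (dir_sphere1 Mu) mulr1.
  by rewrite ger0_norm// exprS; nra.
have qk10 : 0 < q ^+ k.+1 by rewrite exprn_gt0// (lt_trans tau0).
have rQ : 0 < rho * q ^+ k.+1 by rewrite mulr_gt0.
have Uy : U y by apply: ballU; lra.
have back : (dir_min_time (dir (~~ odd k)) y [set x] <= t%:E)%E.
  apply: (dir_min_time_le t0 (dir_opp Mu)) => /=.
  by rewrite /y scalerN addrK.
have back' : (tau%:E * dir_min_time (dir (~~ odd k)) y [set x] <=
    (tau * t)%:E)%E.
  by rewrite EFinM; apply: lee_wpmul2l => //; rewrite lee_fin ltW.
have tauq : tau * t < (1 - q) * rho * q ^+ k.+1.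
  rewrite exprS.
  have : tau * t <= tau * ((1 - q) * rho * q ^+ k) by rewrite ler_wpM2l// ltW.
  move=> /le_lt_trans; apply.
  rewrite mulrCA ltr_pM2l ?mulr_gt0 ?subr_gt0// ltr_pM2r//.
split=> //.
apply: le_lt_trans (_ : (tau * t)%:E < _)%E; last by rewrite lte_fin.
apply: le_trans (back').
rewrite oddS.
apply: GD => //.
apply: le_lt_trans back' _.
(* Localization condition of the Aubin property: the room left around [y] in the ball is at least
   [rho * q ^+ k.+1], which exceeds [tau * t]. *)
apply: (@lt_le_trans _ _ (rho - `|y - xbar|)%:E).
  rewrite lte_fin (lt_le_trans tauq)// -mulrA.
  have : 0 <= q * (rho * q ^+ k.+1) by rewrite mulr_ge0 ?ltW// (lt_trans tau0).
  by lra.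
apply: dist_ge => z Uz.
have rz : rho < `|z - xbar| by rewrite ltNge; apply/negP => /ballU.
have := ler_distD y z xbar; rewrite (distrC z y) => h.
by rewrite lerBlDr (le_trans (ltW rz)).
Qed.

Lemma zigzag_sequence : (dir_min_time M xbar (G xbar) < ((1 - tau) * rho)%:E)%E ->
  exists (q : R) (s : nat -> X) (t : nat -> R) (u : nat -> X),
    [/\ 0 < q < 1, s 0%N = xbar,
        forall k n, `|s (k + n)%N - s k| <= rho * q ^+ k &
        forall k, [/\ 0 <= t k <= rho * q ^+ k, dir (odd k) (u k),
                      s k.+1 = s k + t k *: u k & G (s k) (s k.+1)]].
Proof.
move=> Trho; have /andP[tau0 tau1] := tau01.
have rho0 : 0 < rho.
  have := le_lt_trans (dir_min_time_ge0 M xbar (G xbar)) Trho.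
  by rewrite lte_fin pmulr_rgt0// subr_gt0.
have [q /andP[tq q1] Tq] : exists2 q, tau < q < 1 &
    (dir_min_time M xbar (G xbar) < ((1 - q) * rho)%:E)%E.
  have [c /andP[Tc]] := ereal_between (dir_min_time_ge0 M xbar (G xbar)) Trho.
  rewrite lte_fin -ltr_pdivrMr// => ct.
  have c0 : 0 < c.
    by have := le_lt_trans (dir_min_time_ge0 M xbar (G xbar)) Tc; rewrite lte_fin.
  have cr : 0 < c / rho by rewrite divr_gt0.
  (* Chosen so that [(1 - q) * rho = c], which lies strictly between the minimal time and
     [(1 - tau) * rho]. *)
  exists (1 - c / rho); first by apply/andP; split; lra.
  by rewrite opprB addrCA subrr addr0 divfK ?gt_eqF.
have q0 : 0 < q by exact: lt_trans tq.
(* Guarding by the invariant makes the relation total, as [choice] requires; where the invariant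
   fails, the dummy step [(0, 0)] serves. *)
pose step k x t u := invariant q k x ->
   [/\ 0 <= t <= (1 - q) * rho * q ^+ k, dir (odd k) u,
    G x (x + t *: u) & invariant q k.+1 (x + t *: u)].
have /choice[f fP] : forall kx : nat * X, exists tu : R * X,
    step kx.1 kx.2 tu.1 tu.2.
  move=> [k x]; have [inv|ninv] := pselect (invariant q k x).
    have tq1 : tau < q < 1 by rewrite tq.
    by have [t [u tuP]] := invariant_step tq1 rho0 inv; exists (t, u).
  by exists (0, 0).
pose s := fix s k := if k is k'.+1 then
  s k' + (f (k', s k')).1 *: (f (k', s k')).2 else xbar.
have sI k : invariant q k (s k).
  elim: k => [|k IHk]; last by have [] := fP (k, s k) IHk.
  by split; rewrite /= ?expr0 ?subrr ?normr0 ?mulr0 ?mulr1.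
exists q, s, (fun k => (f (k, s k)).1), (fun k => (f (k, s k)).2).
have sP k : [/\ 0 <= (f (k, s k)).1 <= (1 - q) * rho * q ^+ k,
    dir (odd k) (f (k, s k)).2 & G (s k) (s k.+1)].
  by have [] := fP (k, s k) (sI k).
split=> // [|k n|k].
- by rewrite q0.
(* The factor [1 - q ^+ n] is what makes the induction on [n] close. *)
- suff : `|s (k + n)%N - s k| <= rho * q ^+ k * (1 - q ^+ n).
    move=> /le_trans; apply; rewrite ler_piMr ?mulr_ge0 ?exprn_ge0 ?ltW//.
    by rewrite ltrBlDr ltrDl exprn_gt0.
  elim: n => [|n IHn]; first by rewrite addn0 subrr normr0 expr0 subrr mulr0.
  rewrite addnS /=; have [/andP[t0 tr] Du _] := sP (k + n)%N.
  rewrite addrAC (le_trans (ler_normD _ _))// normrZ (dir_sphere1 Du) mulr1.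
  rewrite ger0_norm//; move: IHn tr; rewrite exprD exprS => IHn tr; nra.
- have [/andP[t0 tr] Du Gs] := sP k; split=> //; rewrite t0/= (le_trans tr)//.
  rewrite -mulrA ler_piMl ?mulr_ge0 ?exprn_ge0 ?ltW//.
  by rewrite ltrBlDr ltrDl.
Qed.

Lemma zigzag_approximations :
  (dir_min_time M xbar (G xbar) < ((1 - tau) * rho)%:E)%E ->
  exists s : nat -> X,
    [/\ successive_approximations G M xbar s,
        forall k, `|s k - xbar| <= rho,
        forall eps, 0 < eps -> \forall k \near \oo,
          (dir_min_time M (s k) (G (s k)) <= eps%:E)%E \/
          (dir_min_time (oppset M) (s k) (G (s k)) <= eps%:E)%E &
        complete_space X -> closed_graph G ->
          exists2 x, Fixset G x & `|x - xbar| <= rho].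
Proof.
move=> /zigzag_sequence[q [s [t [u [/andP[q0 q1] s0 sC sP]]]]].
have q_cvg : (fun k => rho * q ^+ k) @ \oo --> (0 : R).
  by rewrite -[X in _ --> X](mulr0 rho); apply: cvgMr; apply: cvg_expr;
     rewrite ger0_norm// ltW.
have q_near eps : 0 < eps -> \forall k \near \oo, rho * q ^+ k < eps.
  move=> eps0; near=> k; apply: le_lt_trans (ler_norm _) _; near: k.
  exact: cvgr0_norm_lt.
have t_cvg : t @ \oo --> (0 : R).
  apply: (@squeeze_cvgr _ _ _ _ (cst 0) (fun k => rho * q ^+ k)) => //.
    by apply: nearW => k; have [] := sP k.
  exact: cvg_cst.
have sB k : `|s k - xbar| <= rho.
  by have := sC 0%N k; rewrite s0 expr0 mulr1.
exists s; split=> //.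
(* The sign [(-1) ^+ odd k] on both factors brings odd directions back into [M] and cancels in the
   product. *)
- exists (fun k => (-1) ^+ odd k * t k), (fun k => (-1) ^+ odd k *: u k).
  split=> // [k| |k].
  + have [_ + _ _] := sP k; case: (odd k) => /= [[v Mv <-]|].
      by rewrite expr1 scaleN1r opprK.
    by rewrite expr0 scale1r.
  + apply: norm_cvg0; rewrite -[X in _ --> X](normr0 R).
    under eq_cvg do rewrite normrMsign.
    exact: cvg_norm t_cvg.
  + have [_ _ sk Gs] := sP k; split=> //.
    by rewrite scalerA mulrAC -signr_addb addbb mul1r.
- move=> eps eps0; have := q_near _ eps0; apply: filterS => k qe.
  have [/andP[t0 tr] Du sk Gs] := sP k.
  have : (dir_min_time (dir (odd k)) (s k) (G (s k)) <= eps%:E)%E.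
    apply: le_trans (_ : (t k)%:E <= _)%E.
      by apply: (dir_min_time_le t0 Du); rewrite -sk.
    by rewrite lee_fin (le_trans tr) ?ltW.
  by case: (odd k); [right | left].
- move=> Xcomplete Gclosed.
  have s_cvg : cvg (s @ \oo).
    apply: Xcomplete; apply: cauchy_exP => eps eps0.
    have [K _ Kq] := q_near _ eps0; exists (s K), K => // k /= Kk.
    rewrite -ball_normE /= distrC -(subnKC Kk) (le_lt_trans (sC _ _))//.
    exact: (Kq K (leqnn K)).
  exists (lim (s @ \oo)).
    (* Consecutive pairs lie in the graph and both coordinates tend to the same limit, so the limit
       is a fixed point. *)
    apply: (@closed_cvg _ _ \oo _ (fun k => (s k, s k.+1)) _ Gclosed _
        (lim (s @ \oo), lim (s @ \oo))).
      by apply: nearW => k; have [] := sP k.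
    by apply: cvg_pair => //=; rewrite cvg_shiftS.
  apply: (@cvgr_to_le _ \oo _ R (fun k => `|s k - xbar|)).
    by apply: cvg_norm; apply: cvgB => //; exact: cvg_cst.
  exact: nearW.
Unshelve. all: by end_near.
Qed.

End Zigzag.

(** * Estimates obtained by shrinking the radius *)

Lemma theorem_one_direction (R : realType) (X : normedModType R)
    (G : X -> set X) (U M : set X) (tau : R) (xbar : X) :
  M `<=` sphere1 -> 0 < tau < 1 ->
  dir_orbitally_Aubin G U M tau -> dir_orbitally_Aubin G U (oppset M) tau ->
  let T := dir_min_time M xbar (G xbar) in
  (T < (1 - tau)%:E * dist xbar (~` U))%E ->
  [/\ exists s : nat -> X, successive_approximations G M xbar s /\
        forall eps : R, 0 < eps -> exists keps : nat,
          forall k : nat, (keps <= k)%N ->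
            (Fix_approx G eps `&` U) (s k) /\
            ((dir_min_time M (s k) (G (s k)) <= eps%:E)%E \/
             (dir_min_time (oppset M) (s k) (G (s k)) <= eps%:E)%E),
      forall eps : R, 0 < eps ->
        (dist xbar (Fix_approx G eps `&` U) <= T * (1 - tau)^-1%:E)%E &
      complete_space X -> closed_graph G -> Fixset G `&` U !=set0 /\
        (dist xbar (Fixset G `&` U) <= T * (1 - tau)^-1%:E)%E].
Proof.
move=> MS tau01 GM GNM T; have /andP[tau0 tau1] := tau01.
have c0 : 0 < 1 - tau by rewrite subr_gt0.
rewrite muleC -lte_pdivrMr// => Td.
have Tc0 : (0 <= T * (1 - tau)^-1%:E)%E.
  by rewrite mule_ge0 ?dir_min_time_ge0// lee_fin invr_ge0 ltW.
have near_fix rho : (T * (1 - tau)^-1%:E < rho%:E < dist xbar (~` U))%E ->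
  (forall x, `|x - xbar| <= rho -> U x) /\
  (T < ((1 - tau) * rho)%:E)%E.
  move=> /andP[Tr rd]; split.
    move=> x xr; apply: contrapT => Ux; move: rd; apply/negP; rewrite -leNgt.
    by apply: le_trans (dist_le_norm _ Ux) _; rewrite lee_fin distrC.
  by rewrite mulrC EFinM -lte_pdivrMr.
(* The point of [A] may depend on [rho]. If the bound failed, a radius below both [dist xbar A] and
   the distance to the complement of [U] would yield a point of [A] that is too close. *)
have dist_le A : (forall rho,
    (T * (1 - tau)^-1%:E < rho%:E < dist xbar (~` U))%E ->
    exists2 x, A x & `|x - xbar| <= rho) ->
    (dist xbar A <= T * (1 - tau)^-1%:E)%E.
  move=> h; rewrite leNgt; apply/negP => TA.
  have [|rho] := ereal_between Tc0 (_ : _ < Order.min (dist xbar A) (dist xbar (~` U)))%E.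
    by rewrite lt_min TA.
  rewrite lt_min => /and3P[Tr rA rd].
  have [|x Ax xr] := h rho; first by rewrite Tr.
  move: rA; apply/negP; rewrite -leNgt.
  by apply: le_trans (dist_le_norm _ Ax) _; rewrite lee_fin distrC.
have Fix_approxP eps x : (dir_min_time M x (G x) <= eps%:E)%E \/
    (dir_min_time (oppset M) x (G x) <= eps%:E)%E -> Fix_approx G eps x.
  by case; apply: le_trans; apply: dist_le_dir_min_time => //;
    exact: oppset_sphere1.
have [rho0 rho0P] := ereal_between Tc0 Td.
split.
- have [ballU Tr] := near_fix _ rho0P.
  have [s [sG sB sT _]] := zigzag_approximations MS tau01 GM GNM ballU Tr.
  exists s; split=> // eps /sT[K _ Ks]; exists K => k /Ks sk.
  by split=> //; split; [exact: Fix_approxP | exact/ballU].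
- move=> eps eps0; apply: dist_le => rho /near_fix[ballU Tr].
  have [s [_ sB /(_ _ eps0)[K _ Ks] _]] :=
    zigzag_approximations MS tau01 GM GNM ballU Tr.
  exists (s K) => //.
  by split; [apply: Fix_approxP; exact: (Ks K (leqnn K)) | exact/ballU].
- move=> Xcomplete Gclosed.
  have fixed rho : (T * (1 - tau)^-1%:E < rho%:E < dist xbar (~` U))%E ->
      exists2 x, (Fixset G `&` U) x & `|x - xbar| <= rho.
    move=> /near_fix[ballU Tr].
    have [s [_ _ _ /(_ Xcomplete Gclosed)[x Gx xr]]] :=
      zigzag_approximations MS tau01 GM GNM ballU Tr.
    by exists x => //; split=> //; exact: ballU.
  split; last exact: dist_le.
  by have [x Ax _] := fixed _ rho0P; exists x.
Qed.

Theorem theorem3p2 (R : realType) (X : normedModType R) (G : X -> set X)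
    (U L : set X) (tau : R) (xbar : X)
    (U0 : U !=set0) (openU : open U)
    (L0 : L !=set0) (LS : L `<=` sphere1)
    (tau01 : 0 < tau < 1)
    (GL : dir_orbitally_Aubin G U L tau)
    (GNL : dir_orbitally_Aubin G U (oppset L) tau)
    (Uxbar : U xbar) :
  let T := dir_min_time L xbar (G xbar) in
  let TN := dir_min_time (oppset L) xbar (G xbar) in
  let alpha := (T < (1 - tau)%:E * dist xbar (~` U))%E in
  let beta := (TN < (1 - tau)%:E * dist xbar (~` U))%E in
  alpha \/ beta ->
  ((exists s : nat -> X, successive_approximations G L xbar s /\
      forall eps : R, 0 < eps -> exists keps : nat,
        forall k : nat, (keps <= k)%N ->
          (Fix_approx G eps `&` U) (s k) /\
          ((dir_min_time L (s k) (G (s k)) <= eps%:E)%E \/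
           (dir_min_time (oppset L) (s k) (G (s k)) <= eps%:E)%E)) /\
   (forall eps : R, 0 < eps ->
      (alpha ->
        (dist xbar (Fix_approx G eps `&` U) <= T * (1 - tau)^-1%:E)%E) /\
      (beta ->
        (dist xbar (Fix_approx G eps `&` U) <= TN * (1 - tau)^-1%:E)%E))) /\
  (complete_space X -> closed_graph G ->
     [/\ Fixset G `&` U !=set0,
         alpha -> (dist xbar (Fixset G `&` U) <= T * (1 - tau)^-1%:E)%E &
         beta -> (dist xbar (Fixset G `&` U) <= TN * (1 - tau)^-1%:E)%E]).
Proof.
move=> T TN alpha beta ab.
have HL := theorem_one_direction LS tau01 GL GNL.
(* Case [beta] is case [alpha] for [oppset L]: since [oppset] is an involution, the two Aubin
   hypotheses merely swap. *)
have HN := theorem_one_direction (oppset_sphere1 LS) tau01 GNL.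
rewrite oppsetK in HN; move/(_ xbar GL) in HN.
split; first split.
- case: ab => [/HL[]//|/HN[[s [sG sT]] _ _]].
  exists s; split; first exact: successive_approximations_oppset.
  move=> eps /sT[K Ks]; exists K => k /Ks[sk skT]; split=> //.
  by rewrite or_comm.
- by move=> eps eps0; split=> [/HL[_ /(_ _ eps0)]|/HN[_ /(_ _ eps0)]].
- move=> Xcomplete Gclosed; split.
  + by case: ab => [/HL|/HN] [_ _ /(_ Xcomplete Gclosed)[]].
  + by move=> /HL[_ _ /(_ Xcomplete Gclosed)[]].
  + by move=> /HN[_ _ /(_ Xcomplete Gclosed)[]].
Qed.
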